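(* Let $k\ge 2$ be an integer. Then, as formal power series in $q$, $$\sum_{n=0}^\infty a_k(n)q^n = \prod_{n=1}^{\infty} \frac{1-q^{kn}}{1-q^n}\cdot \sum_{n=1}^{\infty} \frac{q^{kn} + 2q^{2kn} +\dots+ (k-1)q^{(k-1)kn}}{1 + q^{kn} + q^{2kn} +\dots+ q^{(k-1)kn}}.$$
   Context: For integers $n\ge 0$ and $k\ge 2$, $a_k(n)$ is the total number of parts divisible by $k$, counted with multiplicity, in all partitions of $n$ in which every part has multiplicity strictly less than $k$. (Writing a partition as $(\lambda_1^{m_1},\ldots,\lambda_\ell^{m_\ell})$ with distinct positive integer parts $\lambda_i$ of multiplicity $m_i\ge1$ and $\sum_i m_i\lambda_i=n$, $a_k(n)$ is the sum over all partitions of $n$ with all $m_i<k$ of $\sum_{i:\,k\mid\lambda_i} m_i$.) *)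

(* Defs.v *)
From HB Require Import structures.
From mathcomp Require Import all_boot all_order all_algebra.
From mathcomp Require Import boolp.

Set Implicit Arguments.
Unset Strict Implicit.
Unset Printing Implicit Defensive.

Import GRing.Theory.
Local Open Scope ring_scope.

Record fps (R : Type) := Fps { fps_coef : nat -> R }.

Notation "f `[[ n ]]" := (fps_coef f n)
  (at level 2, left associativity, format "f `[[ n ]]") : ring_scope.

Lemma fpsP (R : Type) (f g : fps R) : (forall n, f`[[n]] = g`[[n]]) -> f = g.
Proof. by case: f g => [f] [g] /= fg; congr Fps; apply/funext. Qed.

HB.instance Definition _ (R : Type) := gen_eqMixin (fps R).
HB.instance Definition _ (R : Type) := gen_choiceMixin (fps R).

Section Zmodule.
Variable R : zmodType.
Implicit Types f g h : fps R.

Definition fps_zero : fps R := Fps (fun=> 0).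
Definition fps_opp f := Fps (fun n => - f`[[n]]).
Definition fps_add f g := Fps (fun n => f`[[n]] + g`[[n]]).

Fact fps_addA : associative fps_add.
Proof. by move=> f g h; apply: fpsP => n; rewrite /= addrA. Qed.
Fact fps_addC : commutative fps_add.
Proof. by move=> f g; apply: fpsP => n; rewrite /= addrC. Qed.
Fact fps_add0 : left_id fps_zero fps_add.
Proof. by move=> f; apply: fpsP => n; rewrite /= add0r. Qed.
Fact fps_addN : left_inverse fps_zero fps_opp fps_add.
Proof. by move=> f; apply: fpsP => n; rewrite /= addNr. Qed.

HB.instance Definition _ :=
  GRing.isZmodule.Build (fps R) fps_addA fps_addC fps_add0 fps_addN.

End Zmodule.

Section ComRing.
Variable R : comNzRingType.
Implicit Types f g h : fps R.

Definition fps_one : fps R := Fps (fun n => (n == 0)%:R).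
Definition fps_mul f g :=
  Fps (fun n => \sum_(i < n.+1) f`[[i]] * g`[[n - i]]).

Let trunc n f : {poly R} := \poly_(i < n.+1) f`[[i]].

Let coef_trunc n f i : (i <= n)%N -> (trunc n f)`_i = f`[[i]].
Proof. by move=> le_in; rewrite coef_poly ltnS le_in. Qed.

Let coef_mul n f g i : (i <= n)%N ->
  (fps_mul f g)`[[i]] = (trunc n f * trunc n g)`_i.
Proof.
move=> le_in; rewrite coefM; apply: eq_bigr => j _.
rewrite !coef_trunc ?(leq_trans (leq_subr _ _)) //.
by apply: leq_trans le_in; rewrite -ltnS.
Qed.

Fact fps_mulC : commutative fps_mul.
Proof. by move=> f g; apply: fpsP => n; rewrite !(@coef_mul n) // mulrC. Qed.

Fact fps_mulA : associative fps_mul.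
Proof.
move=> f g h; apply: fpsP => n.
have E u v w : (fps_mul u (fps_mul v w))`[[n]]
             = (trunc n u * (trunc n v * trunc n w))`_n.
  rewrite coefM /=; apply: eq_bigr => i _; congr (_ * _).
    by rewrite coef_trunc // -ltnS.
  by rewrite -(@coef_mul n) // leq_subr.
by rewrite E [fps_mul (fps_mul f g) h]fps_mulC E mulrA mulrC.
Qed.

Fact fps_mul1 : left_id fps_one fps_mul.
Proof.
move=> f; apply: fpsP => n; rewrite /= big_ord_recl /= mul1r subn0.
by rewrite big1 ?addr0 // => i _; rewrite mul0r.
Qed.

Fact fps_mulDl : left_distributive fps_mul (@fps_add R).
Proof.
move=> f g h; apply: fpsP => n; rewrite /= -big_split /=.
by apply: eq_bigr => i _; rewrite mulrDl.
Qed.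

Fact fps_one_neq0 : fps_one != fps_zero R.
Proof.
by apply/eqP => /(congr1 (fun f => f`[[0]])) /eqP; rewrite /= oner_eq0.
Qed.

HB.instance Definition _ := GRing.Zmodule_isComNzRing.Build (fps R)
  fps_mulA fps_mulC fps_mul1 fps_mulDl fps_one_neq0.

Definition fps_X : fps R := Fps (fun n => (n == 1)%:R).

End ComRing.

Section ComUnitRing.
Variable R : comUnitRingType.
Implicit Types f g : fps R.

(* The first n coefficients of the inverse of f, obtained by solving
   \sum_(i <= m) f_(m - i) g_i = (m == 0) for g_m, successively in m. *)
Fixpoint fps_inv_prefix f (n : nat) : seq R :=
  if n is m.+1 then
    let s := fps_inv_prefix f m in
    rcons s (f`[[0]]^-1 * ((m == 0)%:R - \sum_(i < m) f`[[m - i]] * s`_i))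
  else [::].

Definition fps_unit : pred (fps R) := fun f => f`[[0]] \is a GRing.unit.

Definition fps_inv f : fps R :=
  if fps_unit f then Fps (fun n => (fps_inv_prefix f n.+1)`_n) else f.

Let size_prefix f n : size (fps_inv_prefix f n) = n.
Proof. by elim: n => //= n IHn; rewrite size_rcons IHn. Qed.

Let nth_prefix f n i : (i < n)%N ->
  (fps_inv_prefix f n)`_i = (fps_inv_prefix f i.+1)`_i.
Proof.
elim: n => // n IHn; rewrite ltnS leq_eqVlt => /predU1P[-> //|lt_in].
by rewrite [in LHS]/= nth_rcons size_prefix lt_in IHn.
Qed.

Fact fps_mulVf : {in fps_unit, left_inverse 1 fps_inv *%R}.
Proof.
move=> f; rewrite unfold_in => uf; apply: fpsP => n.
rewrite /fps_inv ifT //; change (\sum_(i < n.+1)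
  (fps_inv_prefix f i.+1)`_i * f`[[n - i]] = (n == 0)%:R).
rewrite big_ord_recr /= subnn nth_rcons size_prefix ltnn eqxx.
rewrite mulrC mulVKr // addrC -[RHS]addr0 -addrA; congr (_ + _).
apply/eqP; rewrite addrC subr_eq0; apply/eqP; apply: eq_bigr => i _.
by rewrite mulrC [in RHS]nth_prefix.
Qed.

Fact fps_unitPl f g : g * f = 1 -> fps_unit f.
Proof.
move=> /(congr1 (fun h => h`[[0]])).
change (\sum_(i < 1) g`[[i]] * f`[[0 - i]] = 1 -> fps_unit f).
by rewrite big_ord1 => gf1; apply/unitrPr; exists g`[[0]]; rewrite mulrC.
Qed.

Fact fps_inv_out : {in [predC fps_unit], fps_inv =1 id}.
Proof. by move=> f nuf; rewrite /fps_inv ifN. Qed.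

HB.instance Definition _ := GRing.ComNzRing_hasMulInverse.Build (fps R)
  fps_mulVf fps_unitPl fps_inv_out.

End ComUnitRing.

(* Convergence of a sequence of formal power series: each coefficient is
   eventually constant. *)
Definition fps_cvg (R : Type) (u : nat -> fps R) (f : fps R) : Prop :=
  forall n, exists N0, forall N, (N0 <= N)%N -> (u N)`[[n]] = f`[[n]].

(* f = \sum_(n >= 1) u n *)
Definition fps_has_sum (R : zmodType) (u : nat -> fps R) (f : fps R) : Prop :=
  fps_cvg (fun N => \sum_(1 <= n < N.+1) u n) f.

(* f = \prod_(n >= 1) u n *)
Definition fps_has_prod (R : comNzRingType) (u : nat -> fps R) (f : fps R)
  : Prop :=
  fps_cvg (fun N => \prod_(1 <= n < N.+1) u n) f.

(* A partition of n is given by its multiplicities: m i is the multiplicity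
   of the part i.+1, which is 0 when i.+1 does not occur. Parts and
   multiplicities of a partition of n are at most n, hence the finite types. *)
Definition is_partition (n : nat) (m : {ffun 'I_n -> 'I_n.+1}) : bool :=
  (\sum_(i < n) m i * i.+1 == n)%N.

Definition a (k n : nat) : nat :=
  (\sum_(m : {ffun 'I_n -> 'I_n.+1} |
           is_partition m && [forall i, m i < k])
     \sum_(i < n | k %| i.+1) m i)%N.

(* Main.v *)
Require Import Defs.
From mathcomp Require Import all_boot all_order all_algebra.

Import GRing.Theory.
Local Open Scope ring_scope.

(** Let G_i = 1 + q^i + ... + q^((k-1)i) and D_i = q^i + 2q^(2i) + ... +
    (k-1)q^((k-1)i). The factor of index i in the product is G_i, the
    generating function of the multiplicity of the part i in a partition with
    all multiplicities below k; when that multiplicity is counted with itself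
    as a weight, G_i becomes D_i. So the total multiplicity of the part i over
    all such partitions has generating function
    D_i * prod_(l != i) G_l = (D_i / G_i) * prod_l G_l, and summing over the
    multiples i of k gives the identity, since the summand of index n in the
    statement is D_(kn) / G_(kn).

    Infinite sums and products are handled by working modulo q^(n+1) to
    compare coefficients of index n. As G_i is 1 and D_i is 0 modulo q^i, the
    partial products and sums of index n already agree with their limits up to
    that precision (eqmodX_diag), parts and multiplicities larger than n may be
    dropped or added freely (eqmodX_trunc_mult, eqmodX_sum_multiples), and the
    combinatorial content is an expansion of a finite product of finite sums
    (a_coef, then a_coef_quotients). *)

Definition eqmodX {R : Type} (m : nat) (f g : fps R) : Prop :=
  forall i, (i < m)%N -> f`[[i]] = g`[[i]].

Section CongruenceModuloPowers.
Context {R : comNzRingType}.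
Implicit Types (f g u v : fps R) (m n : nat).

Lemma coef_fpsM f g n : (f * g)`[[n]] = \sum_(i < n.+1) f`[[i]] * g`[[n - i]].
Proof. by []. Qed.

Lemma coef_fps1 n : (1 : fps R)`[[n]] = (n == 0)%:R.
Proof. by []. Qed.

Lemma coef_fps_sum (I : Type) (r : seq I) (P : pred I) (F : I -> fps R) n :
  (\sum_(i <- r | P i) F i)`[[n]] = \sum_(i <- r | P i) (F i)`[[n]].
Proof. exact: (big_morph (fun f => f`[[n]])). Qed.

Lemma coef_natrM c f n : (c%:R * f)`[[n]] = c%:R * f`[[n]].
Proof.
elim: c => [|c IHc]; first by rewrite !mul0r.
by rewrite -!natr1 !mulrDl !mul1r -IHc.
Qed.

Lemma coef_fpsXn m n : (fps_X R ^+ m)`[[n]] = (n == m)%:R.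
Proof.
elim: m n => [|m IHm] n; first by rewrite expr0 coef_fps1.
rewrite exprS coef_fpsM; case: n => [|n].
  by rewrite big_ord1 /= mul0r.
rewrite 2!big_ord_recl /= mul0r add0r mul1r subSS subn0 IHm eqSS.
by rewrite big1 ?addr0 // => i _; rewrite mul0r.
Qed.

Lemma eqmodX_sym {m f g} : eqmodX m f g -> eqmodX m g f.
Proof. by move=> fg i /fg. Qed.

Lemma eqmodX_trans {m f g u} : eqmodX m f g -> eqmodX m g u -> eqmodX m f u.
Proof. by move=> fg gu i lt_im; rewrite fg ?gu. Qed.

Lemma eqmodXW {m n f g} : (m <= n)%N -> eqmodX n f g -> eqmodX m f g.
Proof. by move=> le_mn fg i lt_im; apply/fg/(leq_trans lt_im). Qed.

Lemma eqmodXD {m f g u v} :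
  eqmodX m f g -> eqmodX m u v -> eqmodX m (f + u) (g + v).
Proof. by move=> fg uv i lt_im; congr (_ + _); [apply: fg | apply: uv]. Qed.

Lemma eqmodXM {m f g u v} :
  eqmodX m f g -> eqmodX m u v -> eqmodX m (f * u) (g * v).
Proof.
move=> fg uv i lt_im; rewrite !coef_fpsM; apply: eq_bigr => j _.
have le_ji : (j <= i)%N by rewrite -ltnS.
by rewrite fg ?uv // (leq_ltn_trans _ lt_im) // leq_subr.
Qed.

Lemma eqmodX_sum (I : Type) (r : seq I) (P : pred I) (F G : I -> fps R) m :
  (forall i, P i -> eqmodX m (F i) (G i)) ->
  eqmodX m (\sum_(i <- r | P i) F i) (\sum_(i <- r | P i) G i).
Proof. by move=> FG; elim/big_ind2: _ => // *; apply: eqmodXD. Qed.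

Lemma eqmodX_prod (I : Type) (r : seq I) (P : pred I) (F G : I -> fps R) m :
  (forall i, P i -> eqmodX m (F i) (G i)) ->
  eqmodX m (\prod_(i <- r | P i) F i) (\prod_(i <- r | P i) G i).
Proof. by move=> FG; elim/big_ind2: _ => // *; apply: eqmodXM. Qed.

Lemma eqmodX_Xn0 m n : (m <= n)%N -> eqmodX m (fps_X R ^+ n) 0.
Proof.
by move=> le_mn i lt_im; rewrite coef_fpsXn ltn_eqF // (leq_trans lt_im).
Qed.

Lemma eqmodXM0 m f g : eqmodX m f 0 -> eqmodX m (f * g) 0.
Proof. by move=> f0; rewrite -(mul0r g); apply: eqmodXM. Qed.

(** The only possible limit of u when the coefficient of index n is stationary
    from u n on. *)
Definition fps_diag (u : nat -> fps R) : fps R := Fps (fun n => (u n)`[[n]]).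

Section DiagonalLimit.
Context {u : nat -> fps R}.
Hypothesis stab_u : forall N, eqmodX N.+1 (u N.+1) (u N).

Lemma eqmodX_stable n N : (n <= N)%N -> eqmodX n.+1 (u N) (u n).
Proof.
elim: N => [|N IHN]; first by rewrite leqn0 => /eqP->.
rewrite leq_eqVlt => /predU1P[-> //|le_nN].
by apply: eqmodX_trans (IHN le_nN); apply: eqmodXW (stab_u N).
Qed.

Lemma eqmodX_diag n : eqmodX n.+1 (fps_diag u) (u n).
Proof. by move=> i le_in /=; rewrite (eqmodX_stable i n). Qed.

Lemma cvg_diag : fps_cvg u (fps_diag u).
Proof. by move=> n; exists n => N /eqmodX_stable ->. Qed.

End DiagonalLimit.

End CongruenceModuloPowers.

Section PartGeneratingFunctions.
Context {R : comUnitRingType}.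
Implicit Types k i n : nat.

Notation q := (fps_X R).

Definition mult_gf k i : fps R := \sum_(0 <= j < k) q ^+ (j * i).
Definition wmult_gf k i : fps R := \sum_(0 <= j < k) j%:R * q ^+ (j * i).

Lemma unitr_eqmodX1 {f : fps R} : eqmodX 1 f 1 -> f \is a GRing.unit.
Proof.
by move=> f1; change (f`[[0]] \is a GRing.unit); rewrite f1 // unitr1.
Qed.

(** The term j = 0 contributes 1, and every other one is a multiple of q^i. *)
Lemma mult_gf_eqmodX1 k i : (0 < k)%N -> eqmodX i (mult_gf k i) 1.
Proof.
move=> k_gt0; rewrite /mult_gf big_ltn // mul0n expr0 -[X in eqmodX _ _ X]addr0.
apply: eqmodXD => //; rewrite big_nat.
apply: eqmodX_trans (_ : eqmodX i (\sum_(1 <= j < k | (1 <= j < k)%N) 0) 0).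
  by apply: eqmodX_sum => j /andP[j_gt0 _]; apply/eqmodX_Xn0/leq_pmull.
by rewrite big1.
Qed.

Lemma mult_gf_unit k i : (0 < k)%N -> (0 < i)%N ->
  mult_gf k i \is a GRing.unit.
Proof.
by move=> k_gt0 i_gt0; apply/unitr_eqmodX1/(eqmodXW i_gt0)/mult_gf_eqmodX1.
Qed.

Lemma mult_gfE k i : (0 < i)%N ->
  (1 - q ^+ (k * i)) / (1 - q ^+ i) = mult_gf k i.
Proof.
move=> i_gt0; have u1 : 1 - q ^+ i \is a GRing.unit.
  apply: unitr_eqmodX1 => j; rewrite ltnS leqn0 => /eqP->.
  by change (1 - (q ^+ i)`[[0]] = 1); rewrite coef_fpsXn ltn_eqF // subr0.
apply: (canLR (mulrK u1)); rewrite mulrC mulnC exprM -opprB subrX1 -mulNr opprB.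
rewrite /mult_gf big_mkord; congr (_ * _).
by apply: eq_bigr => j _; rewrite mulnC exprM.
Qed.

Lemma wmult_gf_eqmodX0 k i : eqmodX i (wmult_gf k i) 0.
Proof.
apply: eqmodX_trans (_ : eqmodX i (\sum_(0 <= j < k) 0) 0); last by rewrite big1.
apply: eqmodX_sum => -[|j] _; first by rewrite mul0r.
by rewrite mulrC; apply/eqmodXM0/eqmodX_Xn0/leq_pmull.
Qed.

(** Multiplicities of a partition of n are stored in 'I_n.+1; a multiplicity
    j > n of the part i > 0 would only contribute a multiple of q^(n+1), so the
    bound n may be replaced by the bound k alone. *)
Lemma eqmodX_trunc_mult (c : nat -> fps R) k i n : (0 < i)%N ->
  eqmodX n.+1 (\sum_(j < n.+1 | (j < k)%N) c j * q ^+ (j * i))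
              (\sum_(0 <= j < k) c j * q ^+ (j * i)).
Proof.
move=> i_gt0.
(* Both sums become sums over j < n.+1 + k, with different filters. *)
rewrite -(big_mkord (fun j => j < k)%N (fun j => c j * q ^+ (j * i))).
rewrite (big_nat_widen _ _ _ _ _ (leq_addr k n.+1)).
rewrite (big_nat_widen 0 k _ _ _ (leq_addl n.+1 k)).
rewrite [X in eqmodX _ X _]big_mkcondr /=; apply: eqmodX_sum => j _.
case: ltnP => // lt_nj; apply: eqmodX_sym; rewrite mulrC.
by apply/eqmodXM0/eqmodX_Xn0/(leq_trans lt_nj)/leq_pmulr.
Qed.

(** Expanding the product for a fixed i gives one term per choice m of
    multiplicities below k, namely (m i) q^(sum_l m_l (l+1)): the factor l = i
    contributes the weight m_i and the exponent is the size of the partition.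
    Exchanging the sums over i and m recovers the definition of a. *)
Lemma a_coef k n :
  (a k n)%:R = (\sum_(i < n | (k %| i.+1)%N) \prod_(l < n)
     \sum_(j < n.+1 | (j < k)%N)
       (if l == i then j%:R else 1) * q ^+ (j * l.+1))`[[n]].
Proof.
rewrite /a natr_sum coef_fps_sum.
under [RHS]eq_bigr => i _.
  rewrite bigA_distr_big coef_fps_sum.
  under eq_bigr => m _.
    rewrite big_split -expr_sum -big_mkcond big_pred1_eq.
    by rewrite coef_natrM coef_fpsXn over.
  over.
rewrite exchange_big /= [RHS]big_mkcond [LHS]big_mkcond; apply: eq_bigr => m _.
have -> : (m \in ffun_on [pred j : 'I_n.+1 | (j < k)%N])
        = [forall i, (m i < k)%N].
  by apply/ffun_onP/forallP.
rewrite andbC /is_partition eq_sym; case: [forall i, _] => //=.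
case: eqP => _; first by rewrite natr_sum; apply: eq_bigr => i _; rewrite mulr1.
by rewrite big1 // => i _; rewrite mulr0.
Qed.

(** In each product of the previous expansion only the factor of index i
    differs from the full product of the mult_gf k l; as mult_gf k i is a unit,
    the change of factor is multiplication by a quotient that depends on i
    alone, and the full product factors out of the sum over i. *)
Lemma a_coef_quotients k n : (0 < k)%N ->
  (a k n)%:R = ((\prod_(1 <= i < n.+1) mult_gf k i) *
     \sum_(1 <= i < n.+1 | (k %| i)%N) wmult_gf k i / mult_gf k i)`[[n]].
Proof.
move=> k_gt0; rewrite a_coef !big_add1 succnK !big_mkord mulr_sumr.
apply: (eqmodX_sum _ _ _ _ _ n.+1 _ n (ltnSn n)) => i _.
pose c (l : 'I_n) (j : nat) : fps R := if l == i then j%:R else 1.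
apply: eqmodX_trans (_ : eqmodX n.+1
    (\prod_(l < n) \sum_(0 <= j < k) c l j * q ^+ (j * l.+1)) _).
  by apply: eqmodX_prod => l _; apply: (eqmodX_trunc_mult (c l)).
rewrite (bigD1 i) //= (bigD1 (F := fun l : 'I_n => mult_gf k l.+1) i) //=.
rewrite {1}/c eqxx [_ * (_ / _)]mulrC mulrA mulrVK ?mult_gf_unit //.
apply: eqmodXM => //; apply: eqmodX_prod => l /negPf l_i.
by rewrite /c l_i; under eq_bigr do rewrite mul1r.
Qed.

(** Both sums run over the terms E l with k dividing l; the left one goes up to
    l = k * n, but its terms with l > n vanish modulo q^(n+1). *)
Lemma eqmodX_sum_multiples k n (E : nat -> fps R) : (0 < k)%N ->
    (forall i, eqmodX i (E i) 0) ->
  eqmodX n.+1 (\sum_(1 <= i < n.+1) E (k * i)%N)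
              (\sum_(1 <= i < n.+1 | (k %| i)%N) E i).
Proof.
move=> k_gt0 E0.
have <- : \sum_(1 <= i < n.+1 | (k * i < n.+1)%N) E (k * i)%N
        = \sum_(1 <= i < n.+1 | (k %| i)%N) E i.
  rewrite -[LHS]big_filter -(big_map (muln k) predT) -[RHS]big_filter.
  apply/perm_big/uniq_perm; last 1 first.
  - move=> i; apply/mapP/idP => [[j] |].
      rewrite !mem_filter !mem_index_iota => /and3P[lt_kjn j_gt0 _] ->.
      by rewrite dvdn_mulr // muln_gt0 k_gt0 j_gt0.
    rewrite mem_filter mem_index_iota => /and3P[/dvdnP[j ->] ].
    rewrite muln_gt0 => /andP[j_gt0 _] lt_jkn; exists j; last exact: mulnC.
    rewrite mem_filter mem_index_iota mulnC lt_jkn j_gt0 /=.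
    by apply: leq_ltn_trans lt_jkn; apply: leq_pmulr.
  - rewrite map_inj_uniq ?filter_uniq ?iota_uniq // => i j /eqP.
    by rewrite eqn_pmul2l // => /eqP.
  - by rewrite filter_uniq ?iota_uniq.
rewrite [X in eqmodX _ _ X]big_mkcond; apply: eqmodX_sum => i _.
by case: ltnP => // lt_n; apply: eqmodXW lt_n (E0 _).
Qed.

End PartGeneratingFunctions.

Theorem mainTheorem2 (k : nat) (hk : (2 <= k)%N) :
  let q := fps_X int in
  exists P S : fps int,
    [/\ fps_has_prod (fun n => (1 - q ^+ (k * n)) / (1 - q ^+ n)) P,
        fps_has_sum (fun n =>
          (\sum_(1 <= j < k) j%:R * q ^+ (j * k * n)) /
          (\sum_(0 <= j < k) q ^+ (j * k * n))) S
      & Fps (fun n => (a k n)%:Z) = P * S].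
Proof.
move=> q; have k_gt0 : (0 < k)%N := ltnW hk.
pose E i : fps int := wmult_gf k i / mult_gf k i.
have E0 i : eqmodX i (E i) 0 by apply/eqmodXM0/wmult_gf_eqmodX0.
pose p N : fps int := \prod_(1 <= n < N.+1) mult_gf k n.
pose s N : fps int := \sum_(1 <= n < N.+1) E (k * n)%N.
have pE N : \prod_(1 <= n < N.+1) ((1 - q ^+ (k * n)) / (1 - q ^+ n)) = p N.
  by apply: eq_big_nat => n /andP[n_gt0 _]; apply: mult_gfE.
have sE N : \sum_(1 <= n < N.+1) ((\sum_(1 <= j < k) j%:R * q ^+ (j * k * n)) /
              (\sum_(0 <= j < k) q ^+ (j * k * n))) = s N.
  apply: eq_bigr => n _; congr (_ / _); last first.
    by apply: eq_bigr => j _; rewrite mulnA.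
  (* The sum defining wmult_gf starts at j = 0, where the term is zero. *)
  rewrite /wmult_gf [RHS]big_ltn // mul0r add0r.
  by apply: eq_bigr => j _; rewrite mulnA.
have p_stab N : eqmodX N.+1 (p N.+1) (p N).
  rewrite /p big_nat_recr //= -[X in eqmodX _ _ X]mulr1.
  by apply: eqmodXM => //; apply: mult_gf_eqmodX1.
have s_stab N : eqmodX N.+1 (s N.+1) (s N).
  rewrite /s big_nat_recr //= -[X in eqmodX _ _ X]addr0.
  by apply: eqmodXD => //; apply: eqmodXW (E0 _); apply: leq_pmull.
exists (fps_diag p), (fps_diag s); split.
- move=> n; have [N0 cvgN] := cvg_diag p_stab n.
  by exists N0 => N; rewrite pE => /cvgN.
- move=> n; have [N0 cvgN] := cvg_diag s_stab n.
  by exists N0 => N; rewrite sE => /cvgN.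
apply: fpsP => n; rewrite [LHS]/= -natz a_coef_quotients //; apply/esym.
apply: (eqmodXM (eqmodX_diag p_stab n) _ n (ltnSn n)).
apply: eqmodX_trans (eqmodX_diag s_stab n) _.
exact: eqmodX_sum_multiples.
Qed.
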